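(* Let $\Omega\subset\mathbb{H}^2$ be a rotationally symmetric domain of the hyperbolic plane, let $\varepsilon\in\{1,-1\}$, $q>0$, $q\ne1$, and consider in $\Omega$ the equation $$\Delta_{\mathbb{H}^2}u=\varepsilon u|u|^{q-1}.\qquad (E)$$ i) If $\varepsilon=+1$ or $q\neq3$, then any pseudo-radial solution of (E) is radial. ii) The equation $\Delta_{\mathbb{H}^2}u=-u^3$ admits infinitely many non-radial pseudo-radial solutions in $\Omega$, which are all, up to rotation in $\theta$, of the form $$u_k=\pm\frac{w_k(\theta)}{\sinh r},$$ where, for any integer $k\ge2$, $w_k$ is the unique (up to sign and translation) nonconstant solution with least period $\frac{2\pi}{k}$ of the ODE $w''+w=-w^3$.
   Context: $\Delta_{\mathbb{H}^2}$ is the Laplace-Beltrami operator of the hyperbolic plane (curvature $-1$). A rotationally symmetric domain $\Omega$ is identified, via geodesic polar coordinates $(r,\theta)$ around its center, with $I\times\mathbb{S}^1$, $I\subset(0,\infty)$ an open interval, endowed with the metric $dr^2+\sinh^2 r\,d\theta^2$ (so solutions may be singular at the center). Solutions are real-valued classical solutions on $I\times\mathbb{S}^1$. A solution $u$ is pseudo-radial if $u(r,\theta)=h(r)w(\theta)$ for some function $h$ on $I$ and some $2\pi$-periodic function $w$; it is radial if it does not depend on $\theta$, and non-radial otherwise. *)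

(* Defs.v *)
From Stdlib Require Import Reals.
From Coquelicot Require Import Coquelicot.
Open Scope R_scope.

(* First fundamental form E dx^2 + 2 F dx dy + G dy^2 of a surface in
   coordinates (x, y). *)
Record metric2 := Metric2 {
  mE : R -> R -> R;
  mF : R -> R -> R;
  mG : R -> R -> R
}.

Definition D1 (u : R -> R -> R) (x y : R) : R := Derive (fun t => u t y) x.
Definition D2 (u : R -> R -> R) (x y : R) : R := Derive (fun t => u x t) y.

Definition area_density (g : metric2) (x y : R) : R :=
  sqrt (mE g x y * mG g x y - mF g x y ^ 2).

(* |g|^(-1/2) d_i (|g|^(1/2) g^{ij} d_j u), with the 2x2 inverse matrix
   (g^{ij}) = |g|^(-1) [G, -F; -F, E] written out. *)
Definition laplace_beltrami (g : metric2) (u : R -> R -> R) (x y : R) : R :=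
  / area_density g x y *
  (D1 (fun a b => (mG g a b * D1 u a b - mF g a b * D2 u a b)
                  / area_density g a b) x y +
   D2 (fun a b => (mE g a b * D2 u a b - mF g a b * D1 u a b)
                  / area_density g a b) x y).

(* Geodesic polar coordinates (r, theta) on the hyperbolic plane. *)
Definition hyperbolic_metric : metric2 :=
  Metric2 (fun _ _ => 1) (fun _ _ => 0) (fun r _ => sinh r ^ 2).

Definition interval (a b : Rbar) (r : R) : Prop := Rbar_lt a r /\ Rbar_lt r b.

(* A function on I x S^1 is a function u r theta that is 2 PI-periodic in theta
   for r in I; its values for r outside I are irrelevant.  As I is open,
   [ex_diff_n u 2] at all points of I x R means that u is C^2 there. *)
Definition classical_solution (I : R -> Prop) (f : R -> R) (u : R -> R -> R)
  : Prop :=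
  (forall r theta, I r -> u r (theta + 2 * PI) = u r theta) /\
  (forall r theta, I r -> ex_diff_n u 2 r theta) /\
  (forall r theta, I r ->
     laplace_beltrami hyperbolic_metric u r theta = f (u r theta)).

Definition pseudo_radial (I : R -> Prop) (u : R -> R -> R) : Prop :=
  exists h w : R -> R,
    (forall theta, w (theta + 2 * PI) = w theta) /\
    (forall r theta, I r -> u r theta = h r * w theta).

Definition radial (I : R -> Prop) (u : R -> R -> R) : Prop :=
  forall r theta theta', I r -> u r theta = u r theta'.

(* s |s|^(q-1).  It vanishes at s = 0 also when q < 1, since [Rpower] is
   finite everywhere. *)
Definition signed_power (q s : R) : R := s * Rpower (Rabs s) (q - 1).

Definition least_period (T : R) (w : R -> R) : Prop :=
  0 < T /\
  (forall t, w (t + T) = w t) /\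
  (forall S, 0 < S < T -> ~ (forall t, w (t + S) = w t)).

(* [ex_derive_n w 2 t] does not imply that w itself is differentiable. *)
Definition ode_solution (w : R -> R) : Prop :=
  forall t, ex_derive w t /\ ex_derive_n w 2 t /\
            Derive_n w 2 t + w t = - w t ^ 3.

Definition nonconstant (w : R -> R) : Prop := exists s t, w s <> w t.

Definition nonconstant_ode_solution (T : R) (w : R -> R) : Prop :=
  ode_solution w /\ nonconstant w /\ least_period T w.

Definition is_sign (s : R) : Prop := s = 1 \/ s = -1.

Definition nonradial_pseudo_radial_solution (I : R -> Prop) (f : R -> R)
  (u : R -> R -> R) : Prop :=
  classical_solution I f u /\ pseudo_radial I u /\ ~ radial I u.

Definition equal_up_to_rotation (I : R -> Prop) (u v : R -> R -> R) : Prop :=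
  exists alpha, forall r theta, I r -> u r theta = v r (theta + alpha).

(* Main.v *)
Require Import Defs.
From Stdlib Require Import Reals Ranalysis5 ZArith Lra Lia.
From Stdlib Require Import Classical ClassicalEpsilon FunctionalExtensionality.
From Coquelicot Require Import Coquelicot.
Open Scope R_scope.

(* If u = h(r) w(theta) is non-radial, then w takes two nonzero values of
   different modulus, so that w and w |w|^(q-1) are linearly independent and
   separating the variables gives w'' + la w = eps mu w |w|^(q-1) with constants
   la and mu = |h|^(q-1) sinh^2 r.  Hence h is a multiple of (sinh r)^p with
   p = -2/(q-1), and then la = p^2 + (p^2 + p) sinh^2 r is constant only for
   p = -1, that is q = 3.  Up to a factor w solves w'' + w = eps w^3.

   The solutions of w'' + w = - d w^3 (d = -eps) with maximum A are
   A cos(phase), where phase' = sqrt(1 + m/2 (1 + cos^2 phase)), m = d A^2 > -1;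
   a periodic solution is compared with this one at a point where |w| is
   maximal.  The period is strictly decreasing in m, equals 2 PI at m = 0 and
   tends to 0 as m -> +oo.  For d = -1 it exceeds 2 PI, so there is no
   nonconstant 2 PI-periodic solution; for d = 1 it takes each value 2 PI / k
   with k >= 2 exactly once. *)

(** * Calculus preliminaries *)

Lemma is_derive_zero_const (f : R -> R) :
  (forall t, is_derive f t 0) -> forall s t, f s = f t.
Proof.
  intros Hf s t.
  destruct (MVT_gen f s t (fun _ => 0)) as [c [_ Hc]].
  - intros x _. apply Hf.
  - intros x _. apply derivable_continuous_pt. exists 0.
    apply is_derive_Reals, Hf.
  - lra.
Qed.

Lemma is_derive_continuity_pt (f : R -> R) (x l : R) :
  is_derive f x l -> continuity_pt f x.
Proof.
  intros H. apply derivable_continuous_pt. exists l. now apply is_derive_Reals.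
Qed.

Lemma nonneg_derive_le (f df : R -> R) (a b : R) :
  a <= b -> (forall t, is_derive f t (df t)) -> (forall t, 0 <= df t) ->
  f a <= f b.
Proof.
  intros Hab Hf Hdf.
  destruct (MVT_gen f a b df) as [c [_ Hc]].
  - intros x _. apply Hf.
  - intros x _. eapply is_derive_continuity_pt, Hf.
  - assert (0 <= df c * (b - a)) by (apply Rmult_le_pos; [apply Hdf | lra]).
    lra.
Qed.

Lemma cos_eq_1 (x : R) : cos x = 1 -> exists k : Z, x = 2 * PI * IZR k.
Proof.
  intros H. replace x with (2 * (x / 2)) in H by field.
  rewrite cos_2a_sin in H.
  destruct (sin_eq_0_0 (x / 2)) as [k Hk]; [nra |].
  exists k. lra.
Qed.

(** * The cubic oscillator *)

(** The formula comes from energy conservation. With [v = A cos(phase)] and [m = d A^2], the energy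
    identity reads [A^2 sin^2 phase'^2 = A^2 (1 - cos^2) + d/2 A^4 (1 - cos^4)], and [sin^2]
    cancels. For [m > -1] the radicand stays positive, also at the turning points of [v]. *)
Definition speed (m s : R) : R := sqrt (1 + m / 2 * (1 + cos s ^ 2)).

Lemma cos_sqr_bounds (s : R) : 0 <= cos s ^ 2 <= 1.
Proof. pose proof (COS_bound s). nra. Qed.

Lemma speed_radicand_pos (m s : R) :
  -1 < m -> 0 < 1 + m / 2 * (1 + cos s ^ 2).
Proof. intros Hm. pose proof (cos_sqr_bounds s). nra. Qed.

Lemma speed_pos (m s : R) : -1 < m -> 0 < speed m s.
Proof. intros Hm. now apply sqrt_lt_R0, speed_radicand_pos. Qed.

Lemma speed_sqr (m s : R) :
  -1 < m -> speed m s ^ 2 = 1 + m / 2 * (1 + cos s ^ 2).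
Proof.
  intros Hm. apply pow2_sqrt. now apply Rlt_le, speed_radicand_pos.
Qed.

(** A crude global bound: it makes [time] unbounded in both directions and [phase] Lipschitz. *)
Lemma speed_le (m s : R) : -1 < m -> speed m s <= 1 + Rabs m.
Proof.
  intros Hm. pose proof (cos_sqr_bounds s). pose proof (speed_pos m s Hm).
  pose proof (speed_sqr m s Hm). pose proof (Rle_abs m).
  pose proof (Rabs_pos m). nra.
Qed.

Lemma is_derive_speed (m s : R) :
  -1 < m -> is_derive (speed m) s (- (m * cos s * sin s) / (2 * speed m s)).
Proof.
  intros Hm. pose proof (speed_radicand_pos m s Hm).
  pose proof (speed_pos m s Hm).
  unfold speed at 1. auto_derive.
  - simpl in *. lra.
  - change (sqrt _) with (speed m s). field. lra.
Qed.

Lemma continuous_inv_speed (m s : R) :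
  -1 < m -> continuous (fun x => / speed m x) s.
Proof.
  intros Hm. apply (ex_derive_continuous (fun x => / speed m x)).
  apply ex_derive_inv.
  - eexists. now apply is_derive_speed.
  - pose proof (speed_pos m s Hm). lra.
Qed.

Lemma ex_RInt_inv_speed (m x y : R) :
  -1 < m -> ex_RInt (fun s => / speed m s) x y.
Proof.
  intros Hm. apply (ex_RInt_continuous (fun s => / speed m s)).
  intros z _. now apply continuous_inv_speed.
Qed.

(* The time at which the oscillator [w = A cos(phase)] with [m = d A^2] has
   phase [x]; energy conservation gives [phase' = speed m phase]. *)
Definition time (m x : R) : R := RInt (fun s => / speed m s) 0 x.

Lemma time_0 (m : R) : time m 0 = 0.
Proof. apply (RInt_point 0 (fun s => / speed m s)). Qed.

Lemma is_derive_time (m x : R) :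
  -1 < m -> is_derive (time m) x (/ speed m x).
Proof.
  intros Hm. unfold time.
  apply (is_derive_RInt (fun s => / speed m s) _ 0).
  - apply filter_forall. intros y.
    apply (RInt_correct (fun s => / speed m s)). now apply ex_RInt_inv_speed.
  - now apply continuous_inv_speed.
Qed.

Lemma time_increment (m x y : R) :
  -1 < m ->
  exists z, Rmin x y <= z <= Rmax x y /\
    time m y - time m x = / speed m z * (y - x).
Proof.
  intros Hm. apply (MVT_gen (time m) x y (fun z => / speed m z)).
  - intros z _. now apply is_derive_time.
  - intros z _. eapply is_derive_continuity_pt. now apply is_derive_time.
Qed.

Lemma time_lt (m x y : R) : -1 < m -> x < y -> time m x < time m y.
Proof.
  intros Hm Hxy. destruct (time_increment m x y Hm) as [z [_ Hz]].
  pose proof (Rinv_0_lt_compat _ (speed_pos m z Hm)).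
  assert (0 < / speed m z * (y - x)) by (apply Rmult_lt_0_compat; lra).
  lra.
Qed.

Lemma time_inj (m x y : R) : -1 < m -> time m x = time m y -> x = y.
Proof.
  intros Hm H. destruct (Rtotal_order x y) as [h | [h | h]]; trivial.
  - pose proof (time_lt m _ _ Hm h). lra.
  - pose proof (time_lt m _ _ Hm h). lra.
Qed.

(** [speed m] is 2 PI-periodic, so the difference of the two sides has derivative zero. Thus
    [time m (2 * PI)] is the period of the oscillation. *)
Lemma time_shift (m x : R) :
  -1 < m -> time m (x + 2 * PI) = time m x + time m (2 * PI).
Proof.
  intros Hm.
  pose proof (is_derive_zero_const
    (fun x => time m (x + 2 * PI) - time m x)) as H.
  enough (time m (x + 2 * PI) - time m x = time m (0 + 2 * PI) - time m 0)
    by (rewrite time_0, Rplus_0_l in *; lra).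
  apply H. intros t.
  assert (Hs : speed m (t + 2 * PI) = speed m t).
  { unfold speed. now rewrite cos_plus, cos_2PI, sin_2PI, Rmult_1_r, Rmult_0_r,
      Rminus_0_r. }
  pose proof (is_derive_time m t Hm) as H1.
  pose proof (is_derive_time m (t + 2 * PI) Hm) as H2.
  auto_derive; repeat split; try (eexists; eassumption).
  rewrite (is_derive_unique (fun x : R => time m x) _ _ H1).
  rewrite (is_derive_unique (fun x : R => time m x) _ _ H2), Hs. ring.
Qed.

Lemma time_add_periods (m x : R) (n : nat) :
  -1 < m -> time m (x + 2 * PI * INR n) = time m x + time m (2 * PI) * INR n.
Proof.
  intros Hm. induction n as [| n IH].
  - simpl. now rewrite !Rmult_0_r, !Rplus_0_r.
  - rewrite S_INR.
    replace (x + 2 * PI * (INR n + 1)) with (x + 2 * PI * INR n + 2 * PI)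
      by ring.
    rewrite time_shift, IH by trivial. ring.
Qed.

(** The slope of [time m] is at least [/ K], so its values at [K |t|] and [- K |t|] enclose [t], and
    the intermediate value theorem applies. *)
Lemma time_surj (m t : R) : -1 < m -> exists x, time m x = t.
Proof.
  intros Hm.
  set (K := 1 + Rabs m).
  assert (HK : 0 < K) by (unfold K; pose proof (Rabs_pos m); lra).
  assert (Hinv : forall z, / K <= / speed m z).
  { intros z. apply Rinv_le_contravar; [now apply speed_pos |].
    now apply speed_le. }
  assert (HKK : / K * K = 1) by (field; lra).
  destruct (time_increment m 0 (K * Rabs t) Hm) as [z1 [_ H1]].
  destruct (time_increment m 0 (- (K * Rabs t)) Hm) as [z2 [_ H2]].
  rewrite time_0 in H1, H2.
  pose proof (Hinv z1). pose proof (Hinv z2). pose proof (Rabs_pos t).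
  assert (Hpos : 0 <= K * Rabs t) by nra.
  assert (/ K * (K * Rabs t) = Rabs t) by (rewrite <- Rmult_assoc, HKK; ring).
  assert (Rabs t <= time m (K * Rabs t)) by nra.
  assert (time m (- (K * Rabs t)) <= - Rabs t) by nra.
  pose proof (Rle_abs t). pose proof (Rle_abs (- t)). rewrite Rabs_Ropp in *.
  destruct (IVT_gen (time m) (- (K * Rabs t)) (K * Rabs t) t)
    as [x [_ Hx]].
  - intros x. eapply is_derive_continuity_pt. now apply is_derive_time.
  - rewrite Rmin_left, Rmax_right by lra. lra.
  - now exists x.
Qed.

(** The inverse function of [time m], meaningful for [-1 < m], where [time m] is a bijection of the
    line. *)
Definition phase (m t : R) : R := epsilon (inhabits 0) (fun x => time m x = t).

Lemma time_phase (m t : R) : -1 < m -> time m (phase m t) = t.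
Proof.
  intros Hm. apply (epsilon_spec (inhabits 0) (fun x => time m x = t)).
  now apply time_surj.
Qed.

Lemma phase_time (m x : R) : -1 < m -> phase m (time m x) = x.
Proof. intros Hm. apply (time_inj m); trivial. now apply time_phase. Qed.

Lemma phase_0 (m : R) : -1 < m -> phase m 0 = 0.
Proof. intros Hm. rewrite <- (time_0 m) at 1. now apply phase_time. Qed.

Lemma phase_shift (m t : R) :
  -1 < m -> phase m (t + time m (2 * PI)) = phase m t + 2 * PI.
Proof.
  intros Hm. apply (time_inj m); trivial.
  now rewrite time_shift, !time_phase.
Qed.

(** By the mean value theorem for [time], the difference quotient of [phase] equals [speed m z] for
    some [z] between the two phases. The bound [K] on the speed keeps [z] within [K |h|] of
    [phase m t], so continuity of [speed] finishes, with [d / K] as the radius. *)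
Lemma is_derive_phase (m t : R) :
  -1 < m -> is_derive (phase m) t (speed m (phase m t)).
Proof.
  intros Hm. apply is_derive_Reals. intros eps Heps.
  pose proof (is_derive_continuity_pt _ _ _ (is_derive_speed m (phase m t) Hm))
    as Hc.
  rewrite continuity_pt_locally in Hc.
  destruct (Hc (mkposreal eps Heps)) as [d Hd]. simpl in Hd.
  set (K := 1 + Rabs m).
  assert (HK : 0 < K) by (unfold K; pose proof (Rabs_pos m); lra).
  assert (HdK : 0 < d / K) by (apply Rdiv_lt_0_compat; [apply cond_pos | lra]).
  exists (mkposreal _ HdK). simpl. intros h Hh0 Hh.
  destruct (time_increment m (phase m t) (phase m (t + h)) Hm) as [z [Hz E]].
  rewrite !time_phase in E by trivial.
  pose proof (speed_pos m z Hm) as Hs. pose proof (speed_le m z Hm) as Hs'.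
  fold K in Hs'.
  assert (E' : phase m (t + h) - phase m t = speed m z * h).
  { replace h with (t + h - t) at 2 by ring. rewrite E. field. lra. }
  rewrite E'. replace (speed m z * h / h) with (speed m z) by (field; lra).
  apply Hd. unfold ball; simpl; unfold AbsRing_ball; simpl.
  change (Rabs (z - phase m t) < d).
  apply Rle_lt_trans with (Rabs (phase m (t + h) - phase m t)).
  - unfold Rmin, Rmax in Hz. destruct (Rle_dec _ _).
    + rewrite !Rabs_right; lra.
    + rewrite !Rabs_left1; lra.
  - rewrite E', Rabs_mult, (Rabs_right (speed m z)) by lra.
    apply Rle_lt_trans with (K * Rabs h).
    + apply Rmult_le_compat_r; [apply Rabs_pos | lra].
    + apply Rmult_lt_compat_l with (r := K) in Hh; [| lra].
      replace (K * (d / K)) with (pos d) in Hh by (field; lra). lra.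
Qed.

Definition oscillation (m A t : R) : R := A * cos (phase m t).

(** The equation [v'' + v = - d v^3] as a first-order system with an explicit velocity. [d = 1] is
    the equation of the theorem; [d = -1] arises from [eps = 1]. *)
Definition cubic_oscillator (d : R) (v v1 : R -> R) : Prop :=
  forall t, is_derive v t (v1 t) /\ is_derive v1 t (- v t - d * v t ^ 3).

Lemma oscillation_ode (d A : R) :
  -1 < d * A ^ 2 ->
  cubic_oscillator d (oscillation (d * A ^ 2) A)
    (fun t => - (A * sin (phase (d * A ^ 2) t) *
                 speed (d * A ^ 2) (phase (d * A ^ 2) t))).
Proof.
  intros Hm t. set (m := d * A ^ 2) in *.
  pose proof (is_derive_phase m t Hm) as Hp.
  pose proof (is_derive_speed m (phase m t) Hm) as Hs.
  pose proof (speed_pos m (phase m t) Hm) as Hpos.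
  pose proof (speed_sqr m (phase m t) Hm) as Hsq.
  unfold oscillation. split.
  - auto_derive; [repeat split; eexists; eassumption |].
    rewrite (is_derive_unique (fun x : R => phase m x) _ _ Hp). ring.
  - auto_derive; [repeat split; eexists; eassumption |].
    rewrite (is_derive_unique (fun x : R => phase m x) _ _ Hp).
    rewrite (is_derive_unique (fun x : R => speed m x) _ _ Hs).
    set (p := phase m t) in *. pose proof (sin2_cos2 p) as Hsc.
    unfold Rsqr in Hsc.
    (* The chain rule gives [phase'' = - (m / 2) cos p sin p], which produces the second term. *)
    transitivity (- (A * cos p * (speed m p) ^ 2) +
                  A * m * cos p * (sin p * sin p) / 2).
    + field. lra.
    + rewrite Hsq. replace (sin p * sin p) with (1 - cos p * cos p) by lra.
      unfold m. field.
Qed.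

Lemma oscillation_0 (m A : R) : -1 < m -> oscillation m A 0 = A.
Proof. intros Hm. unfold oscillation. rewrite phase_0, cos_0; trivial; ring. Qed.

Lemma oscillation_bound (m A t : R) :
  0 <= A -> Rabs (oscillation m A t) <= A.
Proof.
  intros HA. pose proof (COS_bound (phase m t)). unfold oscillation.
  apply Rabs_le. nra.
Qed.

Lemma oscillation_periodic (m A t : R) :
  -1 < m -> oscillation m A (t + time m (2 * PI)) = oscillation m A t.
Proof.
  intros Hm. unfold oscillation. rewrite phase_shift by trivial.
  now rewrite cos_plus, cos_2PI, sin_2PI, Rmult_1_r, Rmult_0_r, Rminus_0_r.
Qed.

Lemma period_pos (m : R) : -1 < m -> 0 < time m (2 * PI).
Proof.
  intros Hm. rewrite <- (time_0 m). apply time_lt; trivial.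
  pose proof PI_RGT_0. lra.
Qed.

(** The value [A] is attained only at phases that are multiples of 2 PI, and [time] maps [2 PI n] to
    [n] periods. Every period of the oscillation is therefore an integer multiple of
    [time m (2 * PI)]. *)
Lemma oscillation_return (m A S : R) :
  -1 < m -> A <> 0 -> 0 < S -> oscillation m A S = A ->
  exists n : nat, (1 <= n)%nat /\ S = time m (2 * PI) * INR n.
Proof.
  intros Hm HA HS H.
  assert (Hc : cos (phase m S) = 1).
  { unfold oscillation in H. apply (Rmult_eq_reg_l A); trivial. lra. }
  destruct (cos_eq_1 _ Hc) as [k Hk].
  assert (0 < phase m S).
  { apply Rnot_le_lt. intros Hle.
    assert (time m (phase m S) <= time m 0).
    { destruct Hle as [Hlt | ->]; [| lra]. now apply Rlt_le, time_lt. }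
    rewrite time_phase, time_0 in * by trivial. lra. }
  assert (Hk0 : 0 < IZR k) by (pose proof PI_RGT_0; nra).
  apply lt_IZR in Hk0.
  exists (Z.to_nat k). split; [lia |].
  rewrite INR_IZR_INZ, Z2Nat.id by lia.
  pose proof (time_add_periods m 0 (Z.to_nat k) Hm) as T.
  rewrite INR_IZR_INZ, Z2Nat.id in T by lia.
  rewrite time_0, !Rplus_0_l in T. rewrite <- T, <- Hk. now rewrite time_phase.
Qed.

(** * Uniqueness for the initial value problem and classification of periodic solutions *)

Lemma nonneg_derive_bound_zero (D D1 : R -> R) (K t0 t : R) :
  (forall t, is_derive D t (D1 t)) -> (forall t, 0 <= D t) ->
  (forall t, Rabs (D1 t) <= K * D t) -> D t0 = 0 -> D t = 0.
Proof.
  intros HD Hpos HK H0.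
  apply Rle_antisym; [| apply Hpos].
  (* Gronwall by monotonicity: to the right of [t0] the function [D exp(- K t)] is nonincreasing, to
     the left of it [D exp(K t)] is nondecreasing, and both vanish at [t0]. *)
  assert (HE : forall s t, is_derive (fun t => D t * exp (s * t)) t
    ((D1 t + s * D t) * exp (s * t))).
  { intros s x. pose proof (HD x) as Hx. auto_derive.
    - repeat split. eexists; eassumption.
    - rewrite (is_derive_unique (fun x : R => D x) _ _ Hx). ring. }
  pose proof (exp_pos (K * t)). pose proof (exp_pos (- K * t)).
  assert (Habs : forall t, - (K * D t) <= D1 t <= K * D t)
    by (intros x; apply Rabs_le_between; apply HK).
  destruct (Rle_or_lt t0 t) as [h | h].
  - assert (- (D t0 * exp (- K * t0)) <= - (D t * exp (- K * t))).
    { apply (nonneg_derive_le (fun t => - (D t * exp (- K * t)))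
        (fun t => - ((D1 t + - K * D t) * exp (- K * t)))); trivial.
      - intros x. apply (is_derive_opp (fun t => D t * exp (- K * t))). apply HE.
      - intros x. pose proof (Habs x). pose proof (exp_pos (- K * x)). nra. }
    rewrite H0 in *. nra.
  - assert (D t * exp (K * t) <= D t0 * exp (K * t0)).
    { apply (nonneg_derive_le (fun t => D t * exp (K * t))
        (fun t => (D1 t + K * D t) * exp (K * t))); [lra | |].
      - intros x. apply HE.
      - intros x. pose proof (Habs x). pose proof (exp_pos (K * x)). nra. }
    rewrite H0 in *. nra.
Qed.

(** The squared distance in phase space satisfies a linear differential inequality. In its
    derivative the linear terms cancel, and [v^3 - w^3 = C (v - w)] leaves a single product, where
    the bound [M] gives [C <= 3 M^2]. *)
Lemma cubic_oscillator_unique (d M : R) (v v1 w w1 : R -> R) (t0 : R) :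
  cubic_oscillator d v v1 -> cubic_oscillator d w w1 ->
  (forall t, Rabs (v t) <= M) -> (forall t, Rabs (w t) <= M) ->
  v t0 = w t0 -> v1 t0 = w1 t0 -> forall t, v t = w t.
Proof.
  intros Hv Hw Mv Mw E0 E1 t.
  set (C := fun t => v t ^ 2 + v t * w t + w t ^ 2).
  enough ((v t - w t) ^ 2 + (v1 t - w1 t) ^ 2 = 0).
  { apply Rminus_diag_uniq, Rsqr_0_uniq. rewrite Rsqr_pow2.
    pose proof (pow2_ge_0 (v t - w t)). pose proof (pow2_ge_0 (v1 t - w1 t)).
    lra. }
  apply (nonneg_derive_bound_zero
    (fun t => (v t - w t) ^ 2 + (v1 t - w1 t) ^ 2)
    (fun t => - (2 * d * C t * (v t - w t) * (v1 t - w1 t)))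
    (3 * Rabs d * M ^ 2) t0).
  - intros x. destruct (Hv x) as [V1 V2], (Hw x) as [W1 W2].
    auto_derive; [repeat split; eexists; eassumption |].
    rewrite (is_derive_unique (fun x : R => v x) _ _ V1).
    rewrite (is_derive_unique (fun x : R => v1 x) _ _ V2).
    rewrite (is_derive_unique (fun x : R => w x) _ _ W1).
    rewrite (is_derive_unique (fun x : R => w1 x) _ _ W2).
    unfold C. ring.
  - intros x. apply Rplus_le_le_0_compat; apply pow2_ge_0.
  - intros x. specialize (Mv x). specialize (Mw x).
    assert (0 <= M) by (pose proof (Rabs_pos (v x)); lra).
    apply Rabs_le_between in Mv. apply Rabs_le_between in Mw.
    assert (HC : 0 <= C x <= 3 * M ^ 2) by (unfold C; split; nra).
    set (p := v x - w x). set (q := v1 x - w1 x).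
    replace (- (2 * d * C x * p * q)) with (- d * C x * (2 * p * q)) by ring.
    rewrite !Rabs_mult, Rabs_Ropp, (Rabs_right (C x)) by lra.
    assert (Hpq : Rabs 2 * Rabs p * Rabs q <= p ^ 2 + q ^ 2).
    { rewrite <- !Rabs_mult. apply Rabs_le.
      pose proof (pow2_ge_0 (p + q)). pose proof (pow2_ge_0 (p - q)). lra. }
    replace (3 * Rabs d * M ^ 2) with (Rabs d * (3 * M ^ 2)) by ring.
    pose proof (Rabs_pos d). pose proof (Rabs_pos 2). pose proof (Rabs_pos p).
    pose proof (Rabs_pos q).
    apply Rmult_le_compat; trivial.
    { apply Rmult_le_pos; lra. }
    { repeat apply Rmult_le_pos; trivial. }
    apply Rmult_le_compat_l; [trivial | apply HC].
  - rewrite E0, E1. ring.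
Qed.

Lemma periodic_nat (f : R -> R) (T : R) :
  (forall t, f (t + T) = f t) -> forall (n : nat) t, f (t + T * INR n) = f t.
Proof.
  intros Hf n. induction n as [| n IH]; intros t.
  - simpl. now rewrite Rmult_0_r, Rplus_0_r.
  - rewrite S_INR. replace (t + T * (INR n + 1)) with (t + T * INR n + T) by ring.
    now rewrite Hf.
Qed.

Lemma periodic_reduce (f : R -> R) (T : R) :
  0 < T -> (forall t, f (t + T) = f t) ->
  forall t, exists s, 0 <= s <= T /\ f t = f s.
Proof.
  intros HT Hf t.
  assert (HZ : forall (k : Z) t, f (t + T * IZR k) = f t).
  { intros k x. destruct (Z_le_gt_dec 0 k).
    - rewrite <- (Z2Nat.id k), <- INR_IZR_INZ by lia. now apply periodic_nat.
    - rewrite <- (periodic_nat f T Hf (Z.to_nat (- k))).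
      rewrite INR_IZR_INZ, Z2Nat.id, opp_IZR by lia. f_equal. ring. }
  exists (t + T * IZR (- Int_part (t / T))). split; [| now rewrite HZ].
  rewrite opp_IZR. destruct (base_Int_part (t / T)).
  assert (E : t = T * (t / T)) by (field; lra).
  rewrite E at 1 3. split; nra.
Qed.

Lemma periodic_abs_max (f : R -> R) (T : R) :
  0 < T -> (forall t, f (t + T) = f t) -> (forall t, continuity_pt f t) ->
  exists t0, forall t, Rabs (f t) <= Rabs (f t0).
Proof.
  intros HT Hf Hc.
  destruct (continuity_ab_maj (fun t => Rabs (f t)) 0 T) as [t0 [Ht0 _]];
    [lra | |].
  - intros c _. apply (continuity_pt_comp f Rabs); [apply Hc |].
    apply Rcontinuity_abs.
  - exists t0. intros t.
    destruct (periodic_reduce f T HT Hf t) as [s [Hs ->]]. now apply Ht0.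
Qed.

Lemma interior_extremum (f : R -> R) (t0 l : R) :
  is_derive f t0 l -> (forall t, f t <= f t0) -> l = 0.
Proof.
  intros Hf Hmax.
  assert (pr : derivable_pt f t0) by (exists l; now apply is_derive_Reals).
  rewrite <- (is_derive_unique _ _ _ Hf).
  rewrite <- (Derive_Reals f t0 pr).
  apply (deriv_maximum f (t0 - 1) (t0 + 1)); try lra.
  intros x _ _. apply Hmax.
Qed.

Lemma cubic_oscillator_energy (d : R) (v v1 : R -> R) :
  cubic_oscillator d v v1 -> forall s t,
  v1 s ^ 2 + v s ^ 2 + d / 2 * v s ^ 4 = v1 t ^ 2 + v t ^ 2 + d / 2 * v t ^ 4.
Proof.
  intros Hv.
  apply (is_derive_zero_const (fun t => v1 t ^ 2 + v t ^ 2 + d / 2 * v t ^ 4)).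
  intros x. destruct (Hv x) as [V1 V2].
  auto_derive; [repeat split; eexists; eassumption |].
  rewrite (is_derive_unique (fun x : R => v x) _ _ V1).
  rewrite (is_derive_unique (fun x : R => v1 x) _ _ V2). field.
Qed.

Lemma cubic_oscillator_sign_shift (d s c : R) (v v1 : R -> R) :
  is_sign s -> cubic_oscillator d v v1 ->
  cubic_oscillator d (fun t => s * v (t + c)) (fun t => s * v1 (t + c)).
Proof.
  intros Hs Hv t. destruct (Hv (t + c)) as [V1 V2].
  split; (auto_derive; [repeat split; eexists; eassumption |]).
  - rewrite (is_derive_unique (fun x : R => v x) _ _ V1). ring.
  - rewrite (is_derive_unique (fun x : R => v1 x) _ _ V2).
    destruct Hs as [-> | ->]; ring.
Qed.

(** A sign and a translation move a maximum of [|v|] to time 0. There the value is [A > 0] and the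
    velocity is 0, which are the initial data of the oscillation with amplitude [A]. It remains to
    show [d A^2 > -1] before uniqueness can be used. *)
Lemma periodic_cubic_oscillator (d T : R) (v v1 : R -> R) :
  is_sign d -> cubic_oscillator d v v1 -> 0 < T ->
  (forall t, v (t + T) = v t) -> nonconstant v ->
  exists A s c, 0 < A /\ -1 < d * A ^ 2 /\ is_sign s /\
    forall t, v t = s * oscillation (d * A ^ 2) A (t + c).
Proof.
  intros Hd Hv HT Hper [x1 [x2 Hx]].
  destruct (periodic_abs_max v T HT Hper) as [t0 Hmax].
  { intros t. eapply is_derive_continuity_pt, Hv. }
  assert (Hs : exists s, is_sign s /\ s * v t0 = Rabs (v t0)).
  { destruct (Rle_or_lt 0 (v t0)).
    - exists 1. split; [now left | rewrite Rabs_right; lra].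
    - exists (-1). split; [now right | rewrite Rabs_left; lra]. }
  destruct Hs as [s [Hs Est0]].
  set (A := Rabs (v t0)) in *.
  set (w := fun t => s * v (t + t0)). set (w1 := fun t => s * v1 (t + t0)).
  assert (Hw : cubic_oscillator d w w1) by now apply cubic_oscillator_sign_shift.
  assert (Hss : s * s = 1) by (destruct Hs as [-> | ->]; ring).
  assert (Hvw : forall t, v t = s * w (t - t0)).
  { intros t. unfold w. rewrite <- Rmult_assoc, Hss.
    replace (t - t0 + t0) with t by ring. ring. }
  assert (HwA : forall t, Rabs (w t) <= A).
  { intros t. unfold w. rewrite Rabs_mult.
    replace (Rabs s) with 1; [rewrite Rmult_1_l; apply Hmax |].
    destruct Hs as [-> | ->]; [now rewrite Rabs_R1 |].
    rewrite Rabs_left; lra. }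
  assert (Hw0 : w 0 = A) by (unfold w; now rewrite Rplus_0_l).
  assert (Hw10 : w1 0 = 0).
  { apply (interior_extremum w 0); [apply Hw |]. intros t. rewrite Hw0.
    eapply Rle_trans; [apply Rle_abs | apply HwA]. }
  assert (Hneq : exists t, w t <> A).
  { destruct (Req_dec (w (x1 - t0)) A) as [e | e]; [| now eexists; eauto].
    exists (x2 - t0). intros e'. apply Hx. now rewrite !Hvw, e, e'. }
  destruct Hneq as [t1 Ht1].
  assert (HA : 0 < A).
  { destruct (Rabs_pos (v t0)) as [h | h]; [exact h |]. exfalso.
    pose proof (HwA t1) as h1. unfold A in *. rewrite <- h in *.
    apply Ht1. apply Rabs_le_between in h1. lra. }
  assert (HdA : -1 < d * A ^ 2).
  { destruct Hd as [-> | ->]; [nra |].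
    (* For [d = -1] and [A > 1], energy conservation makes [w1^2] negative
       where [w] is slightly below [A]; for [A = 1], [w] is the equilibrium 1. *)
    apply Rnot_le_lt. intros HA1. assert (HA1' : 1 <= A) by nra. clear HA1.
    pose proof (cubic_oscillator_energy _ _ _ Hw) as En.
    destruct HA1' as [HA1 | HA1].
    (* The level [Rmax (w t1) 1] is at least 1, less than [A], and lies between [w t1] and
       [w 0 = A]. *)
    - destruct (IVT_gen w t1 0 (Rmax (w t1) 1)) as [t2 [_ Ht2]].
      + intros t. eapply is_derive_continuity_pt, Hw.
      + rewrite Hw0. pose proof (HwA t1) as h. apply Rabs_le_between in h.
        rewrite Rmin_left, (Rmax_right (w t1) A) by lra.
        split; [apply Rmax_l | apply Rmax_lub; lra].
      + pose proof (En t2 0) as E. rewrite Hw0, Hw10, Ht2 in E.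
        set (c := Rmax (w t1) 1) in *.
        assert (1 <= c) by apply Rmax_r.
        assert (c < A).
        { apply Rmax_lub_lt; trivial. pose proof (HwA t1) as h.
          apply Rabs_le_between in h. lra. }
        (* Energy conservation says that [w1 t2 ^ 2] is minus one half of this product. *)
        assert ((A ^ 2 - c ^ 2) * (A ^ 2 + c ^ 2 - 2) > 0) by
          (apply Rmult_gt_0_compat; nra).
        nra.
    - apply Ht1. rewrite <- HA1 in *.
      apply (cubic_oscillator_unique (-1) 1 w w1 (fun _ => 1) (fun _ => 0) 0);
        trivial.
      + intros t. split; auto_derive; trivial; ring.
      + intros t. rewrite Rabs_R1. lra. }
  exists A, s, (- t0). repeat split; trivial.
  intros t. rewrite Hvw. f_equal.
  apply (cubic_oscillator_unique d A w w1 _ _ 0 Hw (oscillation_ode d A HdA) HwA).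
  - intros x. apply oscillation_bound. lra.
  - now rewrite oscillation_0.
  - rewrite Hw10. simpl. rewrite phase_0, sin_0 by trivial. ring.
Qed.

(** * The period function *)

Lemma speed_lt (m n s : R) : -1 < m -> m < n -> speed m s < speed n s.
Proof.
  intros Hm Hmn. pose proof (cos_sqr_bounds s).
  apply sqrt_lt_1; [| | nra]; apply Rlt_le, speed_radicand_pos; lra.
Qed.

Lemma period_lt (m n : R) :
  -1 < m -> m < n -> time n (2 * PI) < time m (2 * PI).
Proof.
  intros Hm Hmn. pose proof PI_RGT_0.
  apply RInt_lt; [lra | | |].
  - intros x _. now apply continuous_inv_speed.
  - intros x _. apply continuous_inv_speed. lra.
  - intros x _. apply Rinv_lt_contravar; [| now apply speed_lt].
    apply Rmult_lt_0_compat; apply speed_pos; lra.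
Qed.

Lemma period_inj (m n : R) :
  -1 < m -> -1 < n -> time m (2 * PI) = time n (2 * PI) -> m = n.
Proof.
  intros Hm Hn E. destruct (Rtotal_order m n) as [h | [h | h]]; trivial.
  - pose proof (period_lt m n Hm h). lra.
  - pose proof (period_lt n m Hn h). lra.
Qed.

Lemma period_0 : time 0 (2 * PI) = 2 * PI.
Proof.
  unfold time. rewrite (RInt_ext _ (fun _ => 1)).
  - rewrite RInt_const. unfold scal; simpl; unfold mult; simpl. ring.
  - intros x _. unfold speed.
    replace (1 + 0 / 2 * (1 + cos x ^ 2)) with 1 by field.
    rewrite sqrt_1. apply Rinv_1.
Qed.

(** Dropping [cos^2] from the radicand leaves [speed >= K]. This gives the decay of the period for
    large [m]. *)
Lemma period_upper_bound (m K : R) :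
  0 < K -> 0 <= m -> K ^ 2 <= 1 + m / 2 -> time m (2 * PI) <= 2 * PI / K.
Proof.
  intros HK Hm HKm. pose proof PI_RGT_0.
  replace (2 * PI / K) with (RInt (fun _ => / K) 0 (2 * PI)).
  - apply RInt_le; [lra | apply ex_RInt_inv_speed; lra | apply ex_RInt_const |].
    intros x _. apply Rinv_le_contravar; trivial.
    pose proof (cos_sqr_bounds x). pose proof (speed_pos m x).
    apply Rsqr_incr_0; [| lra | apply Rlt_le; lra].
    rewrite !Rsqr_pow2, speed_sqr by lra. nra.
  - rewrite RInt_const. unfold scal; simpl; unfold mult; simpl. field. lra.
Qed.

(** Write [1/x - 1/y = (y^2 - x^2) / (x y (x + y))] for the two speeds: the numerator is linear in
    [n - m], and both speeds are at least 1. Integration then yields continuity of the period in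
    [m]. *)
Lemma inv_speed_lipschitz (m n s : R) :
  0 <= m -> 0 <= n -> Rabs (/ speed m s - / speed n s) <= Rabs (m - n).
Proof.
  intros Hm Hn. pose proof (cos_sqr_bounds s).
  assert (H1 : forall k, 0 <= k -> 1 <= speed k s).
  { intros k Hk. pose proof (speed_pos k s).
    apply Rsqr_incr_0; [| lra | apply Rlt_le; lra].
    rewrite !Rsqr_pow2, speed_sqr by lra. nra. }
  pose proof (H1 m Hm) as Hsm. pose proof (H1 n Hn) as Hsn.
  set (D := speed m s * speed n s * (speed m s + speed n s)).
  assert (HD : 1 <= D).
  { unfold D. assert (1 <= speed m s * speed n s) by nra. nra. }
  replace (/ speed m s - / speed n s)
    with ((n - m) * ((1 + cos s ^ 2) / 2 * / D)).
  - rewrite Rabs_mult, (Rabs_minus_sym m n).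
    rewrite <- (Rmult_1_r (Rabs (n - m))) at 2.
    apply Rmult_le_compat_l; [apply Rabs_pos |].
    assert (0 < / D <= 1).
    { split; [apply Rinv_0_lt_compat; lra |]. rewrite <- Rinv_1.
      apply Rinv_le_contravar; lra. }
    rewrite Rabs_right; nra.
  - transitivity ((speed n s ^ 2 - speed m s ^ 2) * / D).
    + rewrite !speed_sqr by lra. field. lra.
    + unfold D. field. repeat split; lra.
Qed.

Lemma period_lipschitz (m n : R) :
  0 <= m -> 0 <= n ->
  Rabs (time m (2 * PI) - time n (2 * PI)) <= 2 * PI * Rabs (m - n).
Proof.
  intros Hm Hn. pose proof PI_RGT_0.
  assert (E : forall k, 0 <= k -> ex_RInt (fun s => / speed k s) 0 (2 * PI))
    by (intros k Hk; apply ex_RInt_inv_speed; lra).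
  pose proof (RInt_minus _ _ _ _ (E m Hm) (E n Hn)) as H'.
  change (RInt (fun s => / speed m s - / speed n s) 0 (2 * PI)
    = time m (2 * PI) - time n (2 * PI)) in H'.
  rewrite <- H'.
  replace (2 * PI * Rabs (m - n)) with ((2 * PI - 0) * Rabs (m - n)) by ring.
  apply abs_RInt_le_const; [lra | |].
  - apply (ex_RInt_minus (fun s => / speed m s) (fun s => / speed n s)); auto.
  - intros s _. now apply inv_speed_lipschitz.
Qed.

Lemma period_surj (K : R) :
  1 <= K -> exists m, 0 <= m /\ time m (2 * PI) = 2 * PI / K.
Proof.
  intros HK. pose proof PI_RGT_0.
  (* [Rabs] extends the period continuously to the whole line, as [IVT_gen] requires. At 0 the
     period is [2 PI >= 2 PI / K]; at [2 K^2] the upper bound applies because [K^2 <= 1 + K^2]. *)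
  destruct (IVT_gen (fun m => time (Rabs m) (2 * PI)) 0 (2 * K ^ 2) (2 * PI / K))
    as [m [_ Hm]].
  - intros m. apply continuity_pt_locally. intros eps.
    assert (He : 0 < eps / (2 * PI)).
    { apply Rdiv_lt_0_compat; [apply cond_pos | lra]. }
    exists (mkposreal _ He). intros n Hn.
    change (Rabs (n - m) < eps / (2 * PI)) in Hn.
    eapply Rle_lt_trans; [apply period_lipschitz; apply Rabs_pos |].
    apply Rle_lt_trans with (2 * PI * Rabs (n - m)).
    + apply Rmult_le_compat_l; [lra | apply Rabs_triang_inv2].
    + apply Rmult_lt_compat_l with (r := 2 * PI) in Hn; [| lra].
      replace (2 * PI * (eps / (2 * PI))) with (pos eps) in Hn by (field; lra).
      exact Hn.
  - rewrite Rabs_R0, period_0.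
    assert (0 <= K ^ 2) by apply pow2_ge_0.
    assert (HK' : time (Rabs (2 * K ^ 2)) (2 * PI) <= 2 * PI / K).
    { rewrite Rabs_right by lra. apply period_upper_bound; lra. }
    assert (2 * PI / K <= 2 * PI).
    { apply Rmult_le_reg_r with K; [lra |].
      replace (2 * PI / K * K) with (2 * PI) by (field; lra). nra. }
    rewrite Rmin_right, Rmax_left by lra. lra.
  - exists (Rabs m). split; [apply Rabs_pos | exact Hm].
Qed.

(* Unspecified for [k < 2], where no such [A] exists. *)
Definition amplitude (k : nat) : R :=
  epsilon (inhabits 0)
    (fun A => 0 < A /\ time (A ^ 2) (2 * PI) = 2 * PI / INR k).

Lemma amplitude_spec (k : nat) :
  (2 <= k)%nat ->
  0 < amplitude k /\ time (amplitude k ^ 2) (2 * PI) = 2 * PI / INR k.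
Proof.
  intros Hk. unfold amplitude. apply epsilon_spec.
  assert (Hk' : 2 <= INR k) by (apply (le_INR 2) in Hk; simpl in Hk; lra).
  destruct (period_surj (INR k)) as [m [Hm E]]; [lra |].
  exists (sqrt m). rewrite pow2_sqrt by trivial. split; trivial.
  (* [m = 0] would have period 2 PI, which differs from [2 PI / k] for [k >= 2]. *)
  apply sqrt_lt_R0. destruct Hm as [Hm | <-]; trivial. exfalso.
  rewrite period_0 in E. pose proof PI_RGT_0.
  assert (2 * PI * INR k = 2 * PI) by (rewrite E at 1; field; lra). nra.
Qed.

Lemma amplitude_unique (k : nat) (A : R) :
  (2 <= k)%nat -> 0 < A -> time (A ^ 2) (2 * PI) = 2 * PI / INR k ->
  A = amplitude k.
Proof.
  intros Hk HA E. destruct (amplitude_spec k Hk) as [HB EB].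
  assert (E2 : A ^ 2 = amplitude k ^ 2).
  { apply period_inj; [nra | nra |]. now rewrite E, EB. }
  rewrite <- !Rsqr_pow2 in E2. apply Rsqr_inj; lra.
Qed.

(** * The profiles [w_k], normalised to have their maximum at 0, and the classification of 2
    PI-periodic solutions *)

Definition wave (k : nat) : R -> R :=
  oscillation (amplitude k ^ 2) (amplitude k).

Definition wave1 (k : nat) (t : R) : R :=
  - (amplitude k * sin (phase (amplitude k ^ 2) t) *
     speed (amplitude k ^ 2) (phase (amplitude k ^ 2) t)).

Lemma wave_ode (k : nat) : cubic_oscillator 1 (wave k) (wave1 k).
Proof.
  pose proof (oscillation_ode 1 (amplitude k)) as H.
  rewrite Rmult_1_l in H. apply H. nra.
Qed.

Lemma wave_0 (k : nat) : wave k 0 = amplitude k.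
Proof. apply oscillation_0. nra. Qed.

Lemma wave_least_period (k : nat) :
  (2 <= k)%nat -> least_period (2 * PI / INR k) (wave k).
Proof.
  intros Hk. destruct (amplitude_spec k Hk) as [HA <-].
  assert (Hm : -1 < amplitude k ^ 2) by nra.
  pose proof (period_pos _ Hm).
  split; [trivial | split].
  - intros t. now apply oscillation_periodic.
  - intros S HS Hper. specialize (Hper 0).
    rewrite Rplus_0_l, wave_0 in Hper.
    destruct (oscillation_return (amplitude k ^ 2) (amplitude k) S)
      as [n [Hn E]]; trivial; try lra.
    apply le_INR in Hn. simpl in Hn. nra.
Qed.

Lemma wave_2PI_periodic (k : nat) (t : R) :
  (2 <= k)%nat -> wave k (t + 2 * PI) = wave k t.
Proof.
  intros Hk.
  rewrite <- (periodic_nat _ _ (proj1 (proj2 (wave_least_period k Hk))) k t).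
  f_equal. field. apply not_0_INR. lia.
Qed.

Lemma wave_nonconstant (k : nat) : (2 <= k)%nat -> nonconstant (wave k).
Proof.
  (* At the second time the phase is PI, where the wave equals [- amplitude k]. *)
  intros Hk. exists 0, (time (amplitude k ^ 2) PI).
  rewrite wave_0. unfold wave, oscillation.
  rewrite phase_time, cos_PI by (pose proof (pow2_ge_0 (amplitude k)); lra).
  pose proof (proj1 (amplitude_spec k Hk)). lra.
Qed.

Lemma sign_mul_inj (s x y : R) : is_sign s -> s * x = s * y -> x = y.
Proof. intros [-> | ->]; lra. Qed.

(** The solution is an oscillation whose period fits [n >= 1] times into 2 PI. For [d = 1] we have
    [m > 0], the period is below 2 PI and so [n >= 2]; for [d = -1] we have [m < 0] and a period
    above 2 PI, which is impossible. *)
Lemma periodic_solution_classification (d : R) (v v1 : R -> R) :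
  is_sign d -> cubic_oscillator d v v1 ->
  (forall t, v (t + 2 * PI) = v t) -> nonconstant v ->
  d = 1 /\ exists k s c, (2 <= k)%nat /\ is_sign s /\
    forall t, v t = s * wave k (t + c).
Proof.
  intros Hd Hv Hper Hnc. pose proof PI_RGT_0.
  destruct (periodic_cubic_oscillator d (2 * PI) v v1)
    as (A & s & c & HA & Hm & Hs & E); trivial; [lra |].
  set (m := d * A ^ 2) in *.
  destruct (oscillation_return m A (2 * PI)) as [n [Hn En]]; trivial; try lra.
  (* At [t = - c] the oscillation is at its maximum, to which it returns after 2 PI. *)
  { pose proof (Hper (- c)) as P. rewrite !E in P.
    apply sign_mul_inj in P; trivial.
    replace (- c + 2 * PI + c) with (2 * PI) in P by ring.
    replace (- c + c) with 0 in P by ring. now rewrite oscillation_0 in P. }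
  pose proof (le_INR _ _ Hn) as Hn'. simpl in Hn'.
  assert (HA2 : 0 < A ^ 2) by nra.
  destruct Hd as [-> | ->].
  - split; trivial.
    replace m with (A ^ 2) in * by (unfold m; ring).
    pose proof (period_lt 0 (A ^ 2) ltac:(lra) HA2) as P. rewrite period_0 in P.
    assert (Hn2 : (2 <= n)%nat).
    { destruct (Nat.eq_dec n 1) as [-> |]; [| lia].
      change (INR 1) with 1 in En. lra. }
    exists n, s, c. repeat split; trivial. intros t. rewrite E.
    unfold wave. rewrite <- (amplitude_unique n A); trivial.
    apply Rmult_eq_reg_r with (INR n); [| lra].
    rewrite <- En. field. lra.
  - exfalso. assert (Hm0 : m < 0) by (unfold m; lra).
    pose proof (period_lt m 0 Hm Hm0) as P. rewrite period_0 in P.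
    nra.
Qed.

(** * The Laplacian on separated functions *)

Lemma interval_pos (a b : Rbar) (r : R) :
  Rbar_le 0 a -> interval a b r -> 0 < r.
Proof. intros Ha [Hr _]. exact (Rbar_le_lt_trans 0 a r Ha Hr). Qed.

Lemma interval_convex (a b : Rbar) (x y z : R) :
  interval a b x -> interval a b y -> Rmin x y <= z <= Rmax x y ->
  interval a b z.
Proof.
  intros [Hx Hx'] [Hy Hy'] [Hz Hz']. split.
  - apply Rbar_lt_le_trans with (Rmin x y); [| exact Hz].
    unfold Rmin. now destruct (Rle_dec x y).
  - apply Rbar_le_lt_trans with (Rmax x y); [exact Hz' |].
    unfold Rmax. now destruct (Rle_dec x y).
Qed.

Lemma interval_open (a b : Rbar) (r : R) :
  interval a b r -> locally r (interval a b).
Proof.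
  intros [Ha Hb]. apply filter_and.
  - now apply (open_Rbar_gt' r a).
  - now apply (open_Rbar_lt' r b).
Qed.

Lemma interval_two_points (a b : Rbar) :
  Rbar_le 0 a -> Rbar_lt a b ->
  exists r1 r2, r1 < r2 /\ interval a b r1 /\ interval a b r2.
Proof.
  intros Ha Hab. unfold interval.
  destruct a as [a | |], b as [b | |]; simpl in *; try contradiction.
  - exists (a + (b - a) / 3), (a + (b - a) / 2). lra.
  - exists (a + 1), (a + 2). lra.
Qed.

Lemma locally_pos (x : R) : 0 < x -> locally x (fun y => 0 < y).
Proof. apply (open_gt 0). Qed.

Lemma sinh_pos (x : R) : 0 < x -> 0 < sinh x.
Proof. intros Hx. rewrite <- sinh_0. now apply sinh_lt. Qed.

Lemma is_derive_sinh (x : R) : is_derive sinh x (cosh x).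
Proof. apply is_derive_Reals, derivable_pt_lim_sinh. Qed.

Lemma cosh_sqr (x : R) : cosh x ^ 2 = 1 + sinh x ^ 2.
Proof.
  unfold cosh, sinh.
  assert (exp x * exp (- x) = 1) by (rewrite <- exp_plus, Rplus_opp_r; apply exp_0).
  nra.
Qed.

Lemma area_density_hyperbolic (r theta : R) :
  0 < r -> area_density hyperbolic_metric r theta = sinh r.
Proof.
  intros Hr. unfold area_density, hyperbolic_metric. simpl.
  replace (1 * (sinh r * (sinh r * 1)) - 0 * (0 * 1)) with (sinh r ^ 2) by ring.
  apply sqrt_pow2, Rlt_le. now apply sinh_pos.
Qed.

(** The product form is assumed only near [r], because a pseudo-radial function is a product only
    over [I]. The area density is [sinh r], so the radial flux is [sinh r * h'(r)], whose product
    rule calls for differentiability of [Derive h]. *)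
Lemma laplace_beltrami_separated (u : R -> R -> R) (h w : R -> R) (r theta : R) :
  0 < r -> locally r (fun x => forall y, u x y = h x * w y) ->
  ex_derive (Derive h) r ->
  laplace_beltrami hyperbolic_metric u r theta =
  (Derive (Derive h) r + cosh r / sinh r * Derive h r) * w theta +
  h r / sinh r ^ 2 * Derive (Derive w) theta.
Proof.
  intros Hr Hu Hh. pose proof (sinh_pos r Hr) as Hs.
  unfold laplace_beltrami. rewrite area_density_hyperbolic by trivial.
  transitivity (/ sinh r *
    (Derive (fun t => (sinh t * Derive h t) * w theta) r +
     Derive (fun t => h r / sinh r * Derive w t) theta)).
  { f_equal. f_equal.
    - apply Derive_ext_loc.
      generalize (filter_and _ _ (locally_pos r Hr) (locally_locally _ _ Hu)).
      apply filter_imp. intros t [Ht Ht'].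
      rewrite area_density_hyperbolic by trivial.
      unfold D1. rewrite (Derive_ext_loc _ (fun x => h x * w theta)).
      + rewrite Derive_scal_l. pose proof (sinh_pos t Ht). simpl. field. lra.
      + revert Ht'. apply filter_imp. intros x Hx. apply Hx.
    - apply Derive_ext. intros t. rewrite area_density_hyperbolic by trivial.
      unfold D2. rewrite (Derive_ext _ (fun x => h r * w x)).
      + rewrite Derive_scal. simpl. field. lra.
      + intros x. apply (locally_singleton _ _ Hu). }
  rewrite Derive_scal, Derive_scal_l, Derive_mult; trivial;
    [| eexists; apply is_derive_sinh].
  rewrite (is_derive_unique _ _ _ (is_derive_sinh r)). field. lra.
Qed.

Lemma Derive_n_Derive (f : R -> R) (k : nat) (x : R) :
  Derive_n (Derive f) k x = Derive_n f (S k) x.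
Proof.
  replace (S k) with (k + 1)%nat by lia. now rewrite <- Derive_n_comp.
Qed.

(** Both partial derivatives of such a product are again products of one-variable functions, so the
    induction generalises over [p] and [q]. *)
Lemma ex_diff_n_product (n : nat) (p q : R -> R) (x y : R) :
  (forall k, (k <= n)%nat -> ex_derive (Derive_n p k) x) ->
  (forall k, (k <= n)%nat -> ex_derive (Derive_n q k) y) ->
  ex_diff_n (fun u v => p u * q v) n x y.
Proof.
  revert p q. induction n as [| n IH]; intros p q Hp Hq.
  all: pose proof (Hp 0%nat ltac:(lia)) as Hp0.
  all: pose proof (Hq 0%nat ltac:(lia)) as Hq0; simpl in Hp0, Hq0.
  all: assert (Hc : continuity_2d_pt (fun u v => p u * q v) x y) by
    (apply continuity_2d_pt_mult;
     [ apply (continuity_1d_2d_pt_comp p (fun u _ => u));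
       [ destruct Hp0; eapply is_derive_continuity_pt; eassumption
       | apply continuity_2d_pt_id1 ]
     | apply (continuity_1d_2d_pt_comp q (fun _ v => v));
       [ destruct Hq0; eapply is_derive_continuity_pt; eassumption
       | apply continuity_2d_pt_id2 ] ]).
  - exact (conj Hc I).
  - cbn [ex_diff_n]. split; [exact Hc |]. split; [| split; [| split]].
    + apply (ex_derive_mult p (fun _ => q y)); trivial. apply ex_derive_const.
    + now apply (ex_derive_scal q).
    + replace (fun u v => Derive (fun z => p z * q v) u)
        with (fun u v => Derive p u * q v).
      * apply IH; [| auto with arith].
        intros k Hk. apply (ex_derive_ext (Derive_n p (S k))).
        { intros t. symmetry. apply Derive_n_Derive. }
        apply Hp. lia.
      * extensionality u. extensionality v. symmetry. apply Derive_scal_l.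
    + replace (fun u v => Derive (fun z => p u * q z) v)
        with (fun u v => p u * Derive q v).
      * apply IH; [auto with arith |].
        intros k Hk. apply (ex_derive_ext (Derive_n q (S k))).
        { intros t. symmetry. apply Derive_n_Derive. }
        apply Hq. lia.
      * extensionality u. extensionality v. symmetry. apply Derive_scal.
Qed.

Definition inv_sinh_1 (x : R) : R := - cosh x / sinh x ^ 2.
Definition inv_sinh_2 (x : R) : R := 2 * cosh x ^ 2 / sinh x ^ 3 - / sinh x.

Lemma is_derive_inv_sinh (x : R) :
  0 < x -> is_derive (fun x => / sinh x) x (inv_sinh_1 x).
Proof.
  intros Hx. pose proof (sinh_pos x Hx). unfold inv_sinh_1. auto_derive.
  - lra.
  - field. lra.
Qed.

Lemma is_derive_inv_sinh_1 (x : R) :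
  0 < x -> is_derive inv_sinh_1 x (inv_sinh_2 x).
Proof.
  intros Hx. pose proof (sinh_pos x Hx). unfold inv_sinh_1, inv_sinh_2.
  auto_derive.
  - apply Rgt_not_eq. nra.
  - field. lra.
Qed.

Lemma Derive_inv_sinh (x : R) :
  0 < x -> Derive (fun x => / sinh x) x = inv_sinh_1 x.
Proof. intros Hx. now apply is_derive_unique, is_derive_inv_sinh. Qed.

Lemma is_derive_Derive_inv_sinh (x : R) :
  0 < x -> is_derive (Derive (fun x => / sinh x)) x (inv_sinh_2 x).
Proof.
  intros Hx. apply (is_derive_ext_loc inv_sinh_1).
  - generalize (locally_pos x Hx). apply filter_imp. intros y Hy.
    symmetry. now apply Derive_inv_sinh.
  - now apply is_derive_inv_sinh_1.
Qed.

Lemma inv_sinh_smooth (x : R) (k : nat) :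
  0 < x -> (k <= 2)%nat -> ex_derive (Derive_n (fun x => / sinh x) k) x.
Proof.
  intros Hx Hk. destruct k as [| [| [| k]]]; [| | | lia]; simpl.
  - eexists. now apply is_derive_inv_sinh.
  - eexists. now apply is_derive_Derive_inv_sinh.
  - apply (ex_derive_ext_loc inv_sinh_2).
    + generalize (locally_pos x Hx). apply filter_imp. intros y Hy.
      symmetry. now apply is_derive_unique, is_derive_Derive_inv_sinh.
    + pose proof (sinh_pos x Hx). unfold inv_sinh_2. auto_derive.
      repeat split; try lra. exact (pow_nonzero (sinh x) 3 (Rgt_not_eq _ _ H)).
Qed.

Lemma cubic_oscillator_Derive (d : R) (v v1 : R -> R) :
  cubic_oscillator d v v1 ->
  (forall t, Derive v t = v1 t) /\
  (forall t, is_derive (Derive v) t (- v t - d * v t ^ 3)).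
Proof.
  intros Hv.
  assert (H1 : forall t, Derive v t = v1 t)
    by (intros t; apply is_derive_unique, Hv).
  split; trivial. intros t. apply (is_derive_ext v1); [now auto |]. apply Hv.
Qed.

Lemma cubic_oscillator_smooth (d : R) (v v1 : R -> R) (t : R) (k : nat) :
  cubic_oscillator d v v1 -> (k <= 2)%nat -> ex_derive (Derive_n v k) t.
Proof.
  intros Hv Hk. destruct (cubic_oscillator_Derive d v v1 Hv) as [_ H2].
  destruct k as [| [| [| k]]]; [| | | lia]; simpl.
  - eexists. apply Hv.
  - eexists. apply H2.
  - apply (ex_derive_ext (fun t => - v t - d * v t ^ 3)).
    + intros x. symmetry. now apply is_derive_unique.
    + pose proof (proj1 (Hv t)). auto_derive.
      repeat split; eexists; eassumption.
Qed.

(** For [h = 1 / sinh] one has [h'' + coth h' = (cosh^2 - sinh^2) / sinh^3 = h^3]. The Laplacian of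
    [h v] is then [h^3 (v + v'') = - (h v)^3]. *)
Lemma inv_sinh_separated_solution (I : R -> Prop) (v v1 : R -> R) :
  (forall r, I r -> 0 < r) -> cubic_oscillator 1 v v1 ->
  (forall t, v (t + 2 * PI) = v t) ->
  classical_solution I (fun s => - s ^ 3) (fun r theta => / sinh r * v theta).
Proof.
  intros HI Hv Hper. split; [| split].
  - intros r theta _. now rewrite Hper.
  - intros r theta Hr. apply ex_diff_n_product.
    + intros k Hk. apply inv_sinh_smooth; auto.
    + intros k Hk. eapply cubic_oscillator_smooth; eassumption.
  - intros r theta Hr. specialize (HI r Hr). pose proof (sinh_pos r HI).
    rewrite (laplace_beltrami_separated _ (fun r => / sinh r) v); trivial.
    + rewrite (is_derive_unique _ _ _ (is_derive_Derive_inv_sinh r HI)).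
      rewrite Derive_inv_sinh by trivial.
      rewrite (is_derive_unique _ _ _
        (proj2 (cubic_oscillator_Derive _ _ _ Hv) theta)).
      unfold inv_sinh_2, inv_sinh_1.
      transitivity
        (((cosh r ^ 2 - sinh r ^ 2 - 1) * v theta - v theta ^ 3) / sinh r ^ 3).
      * field. lra.
      * rewrite cosh_sqr. field. lra.
    + now apply filter_forall.
    + eexists. now apply is_derive_Derive_inv_sinh.
Qed.

Lemma sign_wave_nonradial_solution (a b : Rbar) (k : nat) (s : R) :
  Rbar_le 0 a -> Rbar_lt a b -> (2 <= k)%nat -> is_sign s ->
  nonradial_pseudo_radial_solution (interval a b) (fun x => - x ^ 3)
    (fun r theta => s * (wave k theta / sinh r)).
Proof.
  intros Ha Hab Hk Hs.
  (* The shift by 0 matches the form [s * v (t + c)] of [cubic_oscillator_sign_shift]. *)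
  replace (fun r theta => s * (wave k theta / sinh r))
    with (fun r theta => / sinh r * (s * wave k (theta + 0))).
  2: { extensionality r. extensionality theta. rewrite Rplus_0_r.
       unfold Rdiv. ring. }
  split; [| split].
  - eapply (inv_sinh_separated_solution _ (fun t => s * wave k (t + 0))).
    + intros r. now apply interval_pos.
    + apply cubic_oscillator_sign_shift; trivial. apply wave_ode.
    + intros t. rewrite !Rplus_0_r. now rewrite wave_2PI_periodic.
  - exists (fun r => / sinh r), (fun t => s * wave k (t + 0)). split; trivial.
    intros t. rewrite !Rplus_0_r. now rewrite wave_2PI_periodic.
  - intros Hrad.
    destruct (interval_two_points a b Ha Hab) as (r & _ & _ & Hr & _).
    destruct (wave_nonconstant k Hk) as (x & y & Hxy). apply Hxy.
    pose proof (sinh_pos r (interval_pos a b r Ha Hr)) as Hp.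
    specialize (Hrad r x y Hr). cbv beta in Hrad.
    rewrite !Rplus_0_r in Hrad.
    apply Rmult_eq_reg_l in Hrad; [| now apply Rinv_neq_0_compat; lra].
    now apply (sign_mul_inj s).
Qed.

(** * Separation of variables *)

Lemma signed_power_mult (q x y : R) :
  signed_power q (x * y) = signed_power q x * signed_power q y.
Proof.
  unfold signed_power.
  destruct (Req_dec x 0) as [-> | Hx]; [ring |].
  destruct (Req_dec y 0) as [-> | Hy]; [ring |].
  rewrite Rabs_mult, <- Rpower_mult_distr by now apply Rabs_pos_lt. ring.
Qed.

Lemma Rpower_inj (x y e : R) :
  0 < x -> 0 < y -> e <> 0 -> Rpower x e = Rpower y e -> x = y.
Proof.
  intros Hx Hy He E. apply ln_inv; trivial.
  apply (f_equal ln) in E. unfold Rpower in E. rewrite !ln_exp in E.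
  now apply Rmult_eq_reg_l in E.
Qed.

Lemma Rpower_Rabs_2 (x : R) : x <> 0 -> Rpower (Rabs x) (3 - 1) = x ^ 2.
Proof.
  intros Hx. replace (3 - 1) with (INR 2) by (simpl; ring).
  rewrite Rpower_pow by now apply Rabs_pos_lt. apply pow2_abs.
Qed.

Lemma signed_power_3 (x : R) : signed_power 3 x = x ^ 3.
Proof.
  unfold signed_power. destruct (Req_dec x 0) as [-> | Hx]; [ring |].
  rewrite Rpower_Rabs_2 by trivial. ring.
Qed.

(** Two distinct values may be opposite, or one of them may be 0. If [w x] has the larger modulus,
    the average [(3 w x + w y) / 4] is also attained; it has the sign of [w x] and a modulus
    strictly smaller but at least [|w x| / 2]. *)
Lemma two_moduli (w : R -> R) (x y : R) :
  continuity w -> w x <> w y ->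
  exists s t, w s <> 0 /\ w t <> 0 /\ Rabs (w s) <> Rabs (w t).
Proof.
  intros Hc.
  assert (Hwlog : forall x y, w x <> w y -> Rabs (w y) <= Rabs (w x) ->
    exists s t, w s <> 0 /\ w t <> 0 /\ Rabs (w s) <> Rabs (w t)).
  { clear x y. intros x y Hne Hle.
    destruct (IVT_gen w x y ((3 * w x + w y) / 4) Hc) as [z [_ Hz]].
    - unfold Rmin, Rmax. destruct (Rle_dec _ _); lra.
    - exists x, z. rewrite Hz. revert Hle. unfold Rabs.
      destruct (Rcase_abs (w x)), (Rcase_abs (w y)),
        (Rcase_abs ((3 * w x + w y) / 4)); intros; repeat split; lra. }
  intros Hne. destruct (Rle_or_lt (Rabs (w y)) (Rabs (w x))).
  - now apply (Hwlog x y).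
  - apply (Hwlog y x); auto. lra.
Qed.

Lemma classical_solution_ext (I : R -> Prop) (f g : R -> R) (u : R -> R -> R) :
  (forall s, f s = g s) -> classical_solution I f u -> classical_solution I g u.
Proof.
  intros Hfg (Hper & Hdiff & Heq). split; [exact Hper | split; [exact Hdiff |]].
  intros r theta Hr. now rewrite <- Hfg, Heq.
Qed.

Lemma cube_solution_iff (I : R -> Prop) (u : R -> R -> R) :
  classical_solution I (fun s => - s ^ 3) u <->
  classical_solution I (fun s => -1 * signed_power 3 s) u.
Proof.
  split; apply classical_solution_ext; intros s; rewrite signed_power_3; ring.
Qed.

Lemma solution_slice_r (I : R -> Prop) (f : R -> R)
  (u : R -> R -> R) (r theta : R) :
  classical_solution I f u -> I r ->
  ex_derive (fun x => u x theta) r /\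
  ex_derive (Derive (fun x => u x theta)) r.
Proof.
  intros (_ & Hdiff & _) Hr. destruct (Hdiff r theta Hr) as (_ & H1 & _ & H2 & _).
  split; trivial. now destruct H2 as (_ & H2 & _).
Qed.

Lemma solution_slice_theta (I : R -> Prop) (f : R -> R)
  (u : R -> R -> R) (r theta : R) :
  classical_solution I f u -> I r ->
  ex_derive (u r) theta /\ ex_derive (Derive (u r)) theta.
Proof.
  intros (_ & Hdiff & _) Hr. destruct (Hdiff r theta Hr) as (_ & _ & H1 & _ & H2).
  split; trivial. now destruct H2 as (_ & _ & H2 & _).
Qed.

(** Subtracting the equations at [x] and [y] gives [la x - la y = eps (mu x - mu y) |w|^(q-1)] for
    two different values of [|w|^(q-1)], which forces both differences to vanish. *)
Lemma ode_pair_separation (X : Type) (P : X -> Prop) (la mu : X -> R)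
  (eps wa wa2 wb wb2 q : R) :
  eps <> 0 -> q <> 1 -> wa <> 0 -> wb <> 0 -> Rabs wa <> Rabs wb ->
  (forall x, P x -> la x * wa + wa2 = eps * mu x * signed_power q wa) ->
  (forall x, P x -> la x * wb + wb2 = eps * mu x * signed_power q wb) ->
  forall x y, P x -> P y -> la x = la y /\ mu x = mu y.
Proof.
  intros He Hq Ha Hb Hab Ea Eb x y Hx Hy.
  set (pa := Rpower (Rabs wa) (q - 1)). set (pb := Rpower (Rabs wb) (q - 1)).
  assert (Hp : pa <> pb).
  { intros E. apply Hab. eapply Rpower_inj; try apply E; try lra;
      now apply Rabs_pos_lt. }
  assert (Da : la x - la y = eps * (mu x - mu y) * pa).
  { apply (Rmult_eq_reg_r wa); trivial.
    pose proof (Ea x Hx) as E1. pose proof (Ea y Hy) as E2.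
    unfold signed_power in E1, E2. fold pa in E1, E2. lra. }
  assert (Db : la x - la y = eps * (mu x - mu y) * pb).
  { apply (Rmult_eq_reg_r wb); trivial.
    pose proof (Eb x Hx) as E1. pose proof (Eb y Hy) as E2.
    unfold signed_power in E1, E2. fold pb in E1, E2. lra. }
  assert (E : eps * (pa - pb) * (mu x - mu y) = 0) by lra.
  apply Rmult_integral in E. destruct E as [E | E].
  - apply Rmult_integral in E. destruct E; exfalso; lra.
  - split; [| lra]. rewrite E in Da. lra.
Qed.

Lemma interval_IVT (I : R -> Prop) (f : R -> R) (x y : R) :
  (forall z, Rmin x y <= z <= Rmax x y -> I z) ->
  (forall z, I z -> continuity_pt f z) ->
  f x < 0 -> 0 < f y -> exists z, I z /\ f z = 0.
Proof.
  intros Hc Hf Hx Hy. destruct (Rtotal_order x y) as [h | [h | h]].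
  - rewrite Rmin_left, Rmax_right in Hc by lra.
    destruct (IVT_interv f x y) as [z [Hz E]]; eauto.
  - subst. lra.
  - rewrite Rmin_right, Rmax_left in Hc by lra.
    destruct (IVT_interv (fun z => - f z) y x) as [z [Hz E]]; eauto; try lra.
    + intros z Hz. apply (continuity_pt_opp f). auto.
    + exists z. split; [auto | lra].
Qed.

(* [h^2 - H^2/2] has no zero, hence a constant sign on the interval. *)
Lemma power_law_nonvanishing (I : R -> Prop) (h H : R -> R) (r0 : R) :
  (forall x y z, I x -> I y -> Rmin x y <= z <= Rmax x y -> I z) ->
  (forall r, I r -> continuity_pt h r) -> (forall r, I r -> continuity_pt H r) ->
  (forall r, I r -> 0 < H r) ->
  (forall r, I r -> h r <> 0 -> Rabs (h r) = H r) ->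
  I r0 -> h r0 <> 0 -> forall r, I r -> h r <> 0.
Proof.
  intros Hconv Hh HH Hpos Habs Hr0 Hh0 r Hr E.
  destruct (interval_IVT I (fun x => h x ^ 2 - H x ^ 2 / 2) r r0) as [z [Hz Ez]].
  - intros z. now apply Hconv.
  - intros z Hz. pose proof (Hh z Hz) as C1. pose proof (HH z Hz) as C2.
    apply (continuity_pt_minus (fun x => h x ^ 2) (fun x => H x ^ 2 / 2)).
    + apply (continuity_pt_mult h (fun x => h x * 1)); trivial.
      apply (continuity_pt_mult h (fun _ => 1)); trivial.
      apply continuity_pt_const. now intros ? ?.
    + apply (continuity_pt_mult (fun x => H x ^ 2) (fun _ => / 2)).
      * apply (continuity_pt_mult H (fun x => H x * 1)); trivial.
        apply (continuity_pt_mult H (fun _ => 1)); trivial.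
        apply continuity_pt_const. now intros ? ?.
      * apply continuity_pt_const. now intros ? ?.
  - rewrite E. pose proof (Hpos r Hr). nra.
  - rewrite <- (pow2_abs (h r0)), Habs by trivial. pose proof (Hpos r0 Hr0). nra.
  - pose proof (Hpos z Hz). destruct (Req_dec (h z) 0) as [e | e].
    + rewrite e in Ez. nra.
    + rewrite <- (pow2_abs (h z)), Habs in Ez by trivial. nra.
Qed.

Lemma power_law_abs (q m h s : R) :
  q <> 1 -> h <> 0 -> 0 < s -> Rpower (Rabs h) (q - 1) * s ^ 2 = m ->
  Rabs h = exp ((ln m - 2 * ln s) / (q - 1)).
Proof.
  intros Hq Hh Hs <-. pose proof (Rabs_pos_lt h Hh).
  rewrite ln_mult; [| apply exp_pos | nra].
  unfold Rpower. rewrite ln_exp.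
  replace (s ^ 2) with (s * s) by ring. rewrite ln_mult by trivial.
  replace (((q - 1) * ln (Rabs h) + (ln s + ln s) - 2 * ln s) / (q - 1))
    with (ln (Rabs h)) by (field; lra).
  now rewrite exp_ln.
Qed.

(** Differentiating [h^2 = |h|^2] in two ways avoids the absolute value; one then divides by
    [2 h r]. *)
Lemma power_law_derive (q m h1 : R) (h : R -> R) (r : R) :
  q <> 1 -> 0 < r -> is_derive h r h1 -> h r <> 0 ->
  locally r (fun x => Rabs (h x) = exp ((ln m - 2 * ln (sinh x)) / (q - 1))) ->
  h1 = - 2 / (q - 1) * (cosh r / sinh r * h r).
Proof.
  intros Hq Hr Hd Hh Hl. pose proof (sinh_pos r Hr) as Hs.
  assert (D1 : is_derive (fun x => h x ^ 2) r (2 * h r * h1)).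
  { auto_derive; [repeat split; eexists; exact Hd |].
    rewrite (is_derive_unique (fun x : R => h x) _ _ Hd). ring. }
  assert (D2 : is_derive (fun x => h x ^ 2) r
    (2 * (- 2 / (q - 1) * (cosh r / sinh r)) *
     exp ((ln m - 2 * ln (sinh r)) / (q - 1)) ^ 2)).
  { apply (is_derive_ext_loc
      (fun x => exp ((ln m - 2 * ln (sinh x)) / (q - 1)) ^ 2)).
    - revert Hl. apply filter_imp. intros x <-. apply pow2_abs.
    - auto_derive; [repeat split; lra |].
      unfold Rdiv, Rminus. field. lra. }
  rewrite <- (locally_singleton _ _ Hl), pow2_abs in D2.
  apply is_derive_unique in D1. apply is_derive_unique in D2.
  rewrite D1 in D2.
  apply (Rmult_eq_reg_l (2 * h r)); [| lra]. rewrite D2. ring.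
Qed.

Lemma power_law_exponent (q la : R) (h : R -> R) (I : R -> Prop) (r1 r2 : R) :
  q <> 1 -> (forall r, I r -> 0 < r) -> (forall r, I r -> locally r I) ->
  (forall r, I r -> ex_derive h r) -> (forall r, I r -> h r <> 0) ->
  (forall r, I r -> Derive h r = - 2 / (q - 1) * (cosh r / sinh r * h r)) ->
  (forall r, I r ->
     (Derive (Derive h) r + cosh r / sinh r * Derive h r) * sinh r ^ 2 / h r
     = la) ->
  I r1 -> I r2 -> r1 < r2 -> q = 3 /\ la = 1.
Proof.
  intros Hq Hpos Hopen Hd Hh Hh1 Hla H1 H2 H12.
  set (p := - 2 / (q - 1)) in *.
  assert (E : forall r, I r -> p ^ 2 + (p ^ 2 + p) * sinh r ^ 2 = la).
  { intros r Hr. rewrite <- (Hla r Hr).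
    pose proof (sinh_pos r (Hpos r Hr)) as Hs. pose proof (Hh r Hr) as Hr0.
    assert (D : is_derive (Derive h) r
      (p * ((sinh r ^ 2 - cosh r ^ 2) / sinh r ^ 2 * h r +
            cosh r / sinh r * Derive h r))).
    { apply (is_derive_ext_loc (fun x => p * (cosh x / sinh x * h x))).
      - generalize (Hopen r Hr). apply filter_imp. intros x Hx.
        symmetry. now apply Hh1.
      - pose proof (Hd r Hr). auto_derive; [repeat split; trivial; lra |].
        change (Derive (fun x => h x) r) with (Derive h r). field. lra. }
    rewrite (is_derive_unique _ _ _ D), Hh1 by trivial.
    transitivity (p * (sinh r ^ 2 - cosh r ^ 2) + (p ^ 2 + p) * cosh r ^ 2).
    - rewrite cosh_sqr. ring.
    - field. lra. }
  assert (Hs : sinh r1 ^ 2 < sinh r2 ^ 2).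
  { pose proof (sinh_pos r1 (Hpos r1 H1)). pose proof (sinh_lt _ _ H12). nra. }
  (* Compare [E] at two radii with different [sinh^2]. The root [p = 0] is excluded below by
     [p (q - 1) = -2]. *)
  assert (Hp : p * (p + 1) = 0).
  { pose proof (E r1 H1). pose proof (E r2 H2).
    apply (Rmult_eq_reg_r (sinh r2 ^ 2 - sinh r1 ^ 2)); lra. }
  assert (Hpq : p * (q - 1) = - 2) by (unfold p; field; lra).
  assert (Hp1 : p = -1).
  { apply Rmult_integral in Hp. destruct Hp as [Hp | Hp]; [| lra].
    rewrite Hp in Hpq. lra. }
  split.
  - rewrite Hp1 in Hpq. lra.
  - rewrite <- (E r1 H1), Hp1. ring.
Qed.

Lemma ex_derive_mult_const (f : R -> R) (k x : R) :
  ex_derive f x -> ex_derive (fun x => f x * k) x.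
Proof.
  intros Hf. apply (ex_derive_mult f (fun _ => k)); trivial.
  apply ex_derive_const.
Qed.

Lemma nonradial_solution_form (a b : Rbar) (eps q : R) (u : R -> R -> R) :
  Rbar_le 0 a -> Rbar_lt a b -> is_sign eps -> q <> 1 ->
  classical_solution (interval a b) (fun s => eps * signed_power q s) u ->
  pseudo_radial (interval a b) u -> ~ radial (interval a b) u ->
  q = 3 /\ exists v v1, cubic_oscillator (- eps) v v1 /\
    (forall t, v (t + 2 * PI) = v t) /\ nonconstant v /\
    forall r theta, interval a b r -> u r theta = v theta / sinh r.
Proof.
  intros Ha Hab Heps Hq Hu (h & w & Hper & Hhw) Hnr.
  set (I := interval a b) in *.
  assert (Heps0 : eps <> 0) by (destruct Heps; lra).
  assert (Hpos : forall r, I r -> 0 < r) by (intros r; now apply interval_pos).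
  assert (Hopen : forall r, I r -> locally r I) by (intros r; apply interval_open).
  destruct (not_all_ex_not _ _ Hnr) as [r0 H1].
  apply not_all_ex_not in H1. destruct H1 as [t1 H1].
  apply not_all_ex_not in H1. destruct H1 as [t2 H1].
  apply imply_to_and in H1. destruct H1 as [Hr0 Hne].
  rewrite !Hhw in Hne by trivial.
  assert (Hh0 : h r0 <> 0) by (intros E; rewrite E in Hne; lra).
  assert (Hw12 : w t1 <> w t2) by (intros E; now rewrite E in Hne).
  (* [w] and [h] are arbitrary functions; they inherit regularity from [u] as multiples of its
     slices at [r0] and, further down, at [ta]. *)
  assert (Ew : forall t, u r0 t * / h r0 = w t)
    by (intros t; rewrite Hhw by trivial; field; trivial).
  assert (Hw : forall t, ex_derive w t /\ ex_derive (Derive w) t).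
  { intros t. destruct (solution_slice_theta I _ u r0 t Hu Hr0) as [E1 E2].
    split.
    - apply (ex_derive_ext (fun t => u r0 t * / h r0)); [exact Ew |].
      now apply (ex_derive_mult_const (u r0)).
    - apply (ex_derive_ext (fun t => Derive (u r0) t * / h r0)).
      + intros x. rewrite <- Derive_scal_l. apply Derive_ext, Ew.
      + now apply (ex_derive_mult_const (Derive (u r0))). }
  destruct (two_moduli w t1 t2) as (ta & tb & Hwa & Hwb & Hab'); trivial.
  { intros t. destruct (Hw t) as [[l Hl] _].
    eapply is_derive_continuity_pt, Hl. }
  assert (Eh : forall r, I r -> u r ta * / w ta = h r)
    by (intros r Hr; rewrite Hhw by trivial; field; trivial).
  assert (Hh : forall r, I r -> ex_derive h r /\ ex_derive (Derive h) r).
  { intros r Hr. destruct (solution_slice_r I _ u r ta Hu Hr) as [E1 E2].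
    split.
    - apply (ex_derive_ext_loc (fun r => u r ta * / w ta)).
      + generalize (Hopen r Hr). apply filter_imp. exact Eh.
      + now apply (ex_derive_mult_const (fun r => u r ta)).
    - apply (ex_derive_ext_loc (fun r => Derive (fun x => u x ta) r * / w ta)).
      + generalize (Hopen r Hr). apply filter_imp. intros x Hx.
        rewrite <- Derive_scal_l. apply Derive_ext_loc.
        generalize (Hopen x Hx). apply filter_imp. exact Eh.
      + now apply (ex_derive_mult_const (Derive (fun x => u x ta))). }
  (* These are the coefficients after division of the equation by [h / sinh^2]: each radius with
     [h r <> 0] yields [la w + w'' = eps mu w |w|^(q-1)]. *)
  set (la := fun r => (Derive (Derive h) r + cosh r / sinh r * Derive h r)
                      * sinh r ^ 2 / h r).
  set (mu := fun r => Rpower (Rabs (h r)) (q - 1) * sinh r ^ 2).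
  assert (Hode : forall t r, I r /\ h r <> 0 ->
    la r * w t + Derive (Derive w) t = eps * mu r * signed_power q (w t)).
  { intros t r [Hr Hhr]. pose proof (sinh_pos r (Hpos r Hr)) as Hs.
    destruct Hu as (_ & _ & Hu). specialize (Hu r t Hr).
    rewrite (laplace_beltrami_separated u h w) in Hu; auto.
    - rewrite Hhw, signed_power_mult in Hu by trivial.
      unfold la, mu. unfold signed_power at 1 in Hu.
      set (P := Rpower (Rabs (h r)) (q - 1)) in *.
      set (L := Derive (Derive h) r + cosh r / sinh r * Derive h r) in *.
      apply (Rmult_eq_reg_l (h r / sinh r ^ 2)).
      + transitivity (L * w t + h r / sinh r ^ 2 * Derive (Derive w) t).
        * field. lra.
        * rewrite Hu. field. lra.
      + apply Rmult_integral_contrapositive_currified; trivial.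
        apply Rinv_neq_0_compat, pow_nonzero. lra.
    - generalize (Hopen r Hr). apply filter_imp. auto.
    - now apply Hh. }
  assert (Hconst : forall r, I r -> h r <> 0 -> la r = la r0 /\ mu r = mu r0).
  { intros r Hr Hhr.
    apply (ode_pair_separation R (fun r => I r /\ h r <> 0) la mu eps
      (w ta) (Derive (Derive w) ta) (w tb) (Derive (Derive w) tb) q); auto. }
  assert (Habs : forall r, I r -> h r <> 0 ->
    Rabs (h r) = exp ((ln (mu r0) - 2 * ln (sinh r)) / (q - 1))).
  { intros r Hr Hhr. apply power_law_abs; trivial.
    - now apply sinh_pos, Hpos.
    - now apply Hconst. }
  (* So far [la] and [mu] are known to be constant only where [h] does not vanish; the power law
     with continuity extends this to all of [I]. *)
  assert (Hnz : forall r, I r -> h r <> 0).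
  { apply (power_law_nonvanishing I h
      (fun r => exp ((ln (mu r0) - 2 * ln (sinh r)) / (q - 1))) r0); trivial.
    - apply interval_convex.
    - intros r Hr. destruct (Hh r Hr) as [[l Hl] _].
      eapply is_derive_continuity_pt, Hl.
    - intros r Hr. pose proof (sinh_pos r (Hpos r Hr)).
      apply derivable_continuous_pt, ex_derive_Reals_0. auto_derive. lra.
    - intros r _. apply exp_pos. }
  assert (Hh1 : forall r, I r ->
    Derive h r = - 2 / (q - 1) * (cosh r / sinh r * h r)).
  { intros r Hr. apply (power_law_derive q (mu r0)); auto.
    - now apply Derive_correct, Hh.
    - generalize (Hopen r Hr). apply filter_imp. auto. }
  destruct (interval_two_points a b Ha Hab) as (r1 & r2 & H12 & Hr1 & Hr2).
  destruct (power_law_exponent q (la r0) h I r1 r2) as [Hq3 Hla]; trivial.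
  { intros r Hr. now apply Hh. }
  { intros r Hr. now apply Hconst; auto. }
  split; trivial. subst q.
  (* For [q = 3] the law is [h' = - coth h], so [h sinh] is constant. *)
  set (kappa := h r0 * sinh r0).
  assert (Hs0 : 0 < sinh r0) by (now apply sinh_pos, Hpos).
  assert (Hk : forall r, I r -> h r * sinh r = kappa).
  { intros r Hr.
    destruct (MVT_gen (fun r => h r * sinh r) r0 r (fun _ => 0)) as [c [_ Hc]].
    - intros x Hx.
      assert (HIx : I x) by (apply (interval_convex a b r0 r); trivial; lra).
      pose proof (sinh_pos x (Hpos x HIx)).
      destruct (Hh x HIx) as [Hx1 _]. auto_derive; [repeat split; trivial |].
      change (Derive (fun x => h x) x) with (Derive h x). rewrite Hh1 by trivial.
      field. lra.
    - intros x Hx. assert (HIx : I x) by now apply (interval_convex a b r0 r).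
      destruct (Hh x HIx) as [Hx1 _].
      apply derivable_continuous_pt, ex_derive_Reals_0. auto_derive.
      repeat split; trivial.
    - unfold kappa. lra. }
  assert (Hkap : kappa <> 0)
    by (apply Rmult_integral_contrapositive_currified; lra).
  exists (fun t => kappa * w t), (fun t => kappa * Derive w t).
  split; [| split; [| split]].
  - intros t. destruct (Hw t) as [W1 W2]. split.
    + apply (is_derive_scal w). now apply Derive_correct.
    + replace (- (kappa * w t) - - eps * (kappa * w t) ^ 3)
        with (kappa * Derive (Derive w) t).
      * apply (is_derive_scal (Derive w)). now apply Derive_correct.
      (* Here [mu r0 = kappa^2], so the multiple [kappa w] solves the equation with coefficient
         exactly [eps]. *)
      * pose proof (Hode t r0 (conj Hr0 Hh0)) as E.
        rewrite Hla, signed_power_3 in E. unfold mu in E.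
        rewrite Rpower_Rabs_2 in E by trivial.
        replace (Derive (Derive w) t)
          with (eps * (h r0 ^ 2 * sinh r0 ^ 2) * w t ^ 3 - w t) by lra.
        unfold kappa. ring.
  - intros t. now rewrite Hper.
  - exists t1, t2. intros E. apply Hw12. now apply Rmult_eq_reg_l in E.
  - intros r theta Hr. rewrite Hhw, <- (Hk r Hr) by trivial.
    pose proof (sinh_pos r (Hpos r Hr)). field. lra.
Qed.

(** * Uniqueness of the profiles and pairwise distinctness up to rotation *)

Lemma ode_solution_iff (v : R -> R) :
  ode_solution v <-> cubic_oscillator 1 v (Derive v).
Proof.
  unfold ode_solution, cubic_oscillator. split; intros H t; specialize (H t).
  - destruct H as (H1 & H2 & H3).
    change (Derive (Derive v) t + v t = - v t ^ 3) in H3. split.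
    + now apply Derive_correct.
    + replace (- v t - 1 * v t ^ 3) with (Derive (Derive v) t) by lra.
      now apply Derive_correct.
  - destruct H as (H1 & H2). split; [| split].
    + now eexists; apply H1.
    + simpl. eexists. apply H2.
    + change (Derive (Derive v) t + v t = - v t ^ 3).
      rewrite (is_derive_unique _ _ _ H2). ring.
Qed.

Lemma wave_ode_solution (k : nat) :
  (2 <= k)%nat -> nonconstant_ode_solution (2 * PI / INR k) (wave k).
Proof.
  intros Hk. split; [| split].
  - apply ode_solution_iff. intros t.
    destruct (cubic_oscillator_Derive 1 _ _ (wave_ode k)) as [H1 H2].
    split; [| apply H2]. rewrite H1. apply wave_ode.
  - now apply wave_nonconstant.
  - now apply wave_least_period.
Qed.

Lemma least_period_unique (S T : R) (f : R -> R) :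
  least_period S f -> least_period T f -> S = T.
Proof.
  intros (HS & PS & MS) (HT & PT & MT).
  destruct (Rtotal_order S T) as [h | [h | h]]; trivial; exfalso.
  - now apply (MT S).
  - now apply (MS T).
Qed.

Lemma least_period_sign_shift (s c T : R) (f g : R -> R) :
  is_sign s -> (forall t, g t = s * f (t + c)) ->
  least_period T f -> least_period T g.
Proof.
  intros Hs Hg (HT & PT & MT). split; [trivial | split].
  - intros t. rewrite !Hg. replace (t + T + c) with (t + c + T) by ring.
    now rewrite PT.
  - intros S HS PS. apply (MT S HS). intros t.
    pose proof (PS (t - c)) as E. rewrite !Hg in E.
    apply sign_mul_inj in E; trivial.
    replace (t - c + S + c) with (t + S) in E by ring.
    now replace (t - c + c) with t in E by ring.
Qed.

Lemma div_INR_inj (x : R) (n m : nat) :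
  x <> 0 -> n <> 0%nat -> m <> 0%nat -> x / INR n = x / INR m -> n = m.
Proof.
  intros Hx Hn Hm E. apply INR_eq, Rinv_eq_reg.
  now apply (Rmult_eq_reg_l x).
Qed.

(** Since [k] periods make 2 PI, the classification yields some [wave n] up to sign and translation;
    equality of the least periods gives [n = k]. *)
Lemma ode_solution_unique (k : nat) (v : R -> R) :
  (2 <= k)%nat -> nonconstant_ode_solution (2 * PI / INR k) v ->
  exists s c, is_sign s /\ forall t, v t = s * wave k (t + c).
Proof.
  intros Hk (Hode & Hnc & Hlp). apply ode_solution_iff in Hode.
  assert (Hk0 : INR k <> 0) by (apply not_0_INR; lia).
  destruct (periodic_solution_classification 1 v (Derive v))
    as (_ & n & s & c & Hn & Hs & E); trivial.
  - now left.
  - intros t. rewrite <- (periodic_nat v _ (proj1 (proj2 Hlp)) k t).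
    f_equal. now field.
  - assert (HT : 2 * PI / INR n = 2 * PI / INR k).
    { apply (least_period_unique _ _ v); trivial.
      apply (least_period_sign_shift s c _ (wave n)); trivial.
      now apply wave_least_period. }
    apply div_INR_inj in HT; [| pose proof PI_RGT_0; lra | lia | lia].
    subst n. now exists s, c.
Qed.

(** On a single circle the profiles would be translates of each other, hence have the same least
    period. *)
Lemma wave_rotation_inj (a b : Rbar) (n m : nat) :
  Rbar_le 0 a -> Rbar_lt a b -> (2 <= n)%nat -> (2 <= m)%nat ->
  equal_up_to_rotation (interval a b)
    (fun r theta => 1 * (wave n theta / sinh r))
    (fun r theta => 1 * (wave m theta / sinh r)) -> n = m.
Proof.
  intros Ha Hab Hn Hm [alpha E].
  destruct (interval_two_points a b Ha Hab) as (r & _ & _ & Hr & _).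
  pose proof (sinh_pos r (interval_pos a b r Ha Hr)) as Hs.
  assert (E' : forall t, wave n t = wave m (t + alpha)).
  { intros t. pose proof (E r t Hr) as Et. cbv beta in Et.
    apply (Rmult_eq_reg_r (/ sinh r)); [| now apply Rinv_neq_0_compat; lra].
    unfold Rdiv in Et. lra. }
  assert (HT : 2 * PI / INR n = 2 * PI / INR m).
  { apply (least_period_unique _ _ (wave n)); [now apply wave_least_period |].
    apply (least_period_sign_shift 1 alpha _ (wave m)).
    - now left.
    - intros t. rewrite E'. ring.
    - now apply wave_least_period. }
  apply div_INR_inj in HT; trivial; try lia. pose proof PI_RGT_0. lra.
Qed.

Theorem theorem7 :
  forall a b : Rbar, Rbar_le 0 a -> Rbar_lt a b ->
  (forall eps q : R, is_sign eps -> 0 < q -> q <> 1 ->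
     eps = 1 \/ q <> 3 ->
     forall u : R -> R -> R,
       classical_solution (interval a b) (fun s => eps * signed_power q s) u ->
       pseudo_radial (interval a b) u ->
       radial (interval a b) u)
  /\
  (exists U : nat -> R -> R -> R,
     (forall n : nat,
        nonradial_pseudo_radial_solution (interval a b) (fun s => - s ^ 3)
          (U n)) /\
     (forall n m : nat, n <> m ->
        ~ equal_up_to_rotation (interval a b) (U n) (U m)))
  /\
  (exists w : nat -> R -> R,
     (forall k : nat, (2 <= k)%nat ->
        nonconstant_ode_solution (2 * PI / INR k) (w k) /\
        (forall v : R -> R,
           nonconstant_ode_solution (2 * PI / INR k) v ->
           exists s c : R, is_sign s /\
             forall t : R, v t = s * w k (t + c))) /\
     (forall (k : nat) (s : R), (2 <= k)%nat -> is_sign s ->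
        nonradial_pseudo_radial_solution (interval a b) (fun x => - x ^ 3)
          (fun r theta => s * (w k theta / sinh r))) /\
     (forall u : R -> R -> R,
        nonradial_pseudo_radial_solution (interval a b) (fun x => - x ^ 3) u ->
        exists (k : nat) (s : R), (2 <= k)%nat /\ is_sign s /\
          equal_up_to_rotation (interval a b) u
            (fun r theta => s * (w k theta / sinh r)))).
Proof.
  intros a b Ha Hab. split; [| split].
  - intros eps q Heps _ Hq Hcase u Hu Hpr. apply NNPP. intros Hnr.
    destruct (nonradial_solution_form a b eps q u)
      as (Hq3 & v & v1 & Hv & Hper & Hnc & _); trivial.
    (* The profile solves the oscillator with [d = - eps], so the classification forces [eps = -1].
       Together with [q = 3] this contradicts [Hcase]. *)
    destruct (periodic_solution_classification (- eps) v v1) as [E _]; trivial.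
    + destruct Heps as [-> | ->]; [right | left]; ring.
    + destruct Hcase; lra.
  (* The index [n + 2] runs through the integers [k >= 2]. *)
  - exists (fun n r theta => 1 * (wave (n + 2) theta / sinh r)). split.
    + intros n. apply sign_wave_nonradial_solution; trivial; [lia | now left].
    + intros n m Hnm E. apply Hnm.
      apply wave_rotation_inj in E; trivial; lia.
  - exists wave. split; [| split].
    + intros k Hk. split; [now apply wave_ode_solution |].
      intros v. now apply ode_solution_unique.
    + intros k s Hk Hs. now apply sign_wave_nonradial_solution.
    + intros u (Hu & Hpr & Hnr). apply cube_solution_iff in Hu.
      destruct (nonradial_solution_form a b (-1) 3 u)
        as (_ & v & v1 & Hv & Hper & Hnc & Huv); trivial; [now right | lra |].
      destruct (periodic_solution_classification (- -1) v v1)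
        as (_ & k & s & c & Hk & Hs & E); trivial; [left; ring |].
      exists k, s. repeat split; trivial. exists c. intros r theta Hr.
      rewrite Huv, E by trivial. unfold Rdiv. ring.
Qed.
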